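(* The mould $pal$ is symmetral.
   Context: Moulds are families of functions $A(u_1,\dots,u_r)$, $r\ge0$; $mu(A,B)(u_1..u_r)=\sum_{i=0}^rA(u_1..u_i)B(u_{i+1}..u_r)$; $(dur\,A)(u_1..u_r)=(u_1+\dots+u_r)A(u_1..u_r)$. $dupal$ is the mould with $dupal(\emptyset)=0$ and $dupal(u_1,\dots,u_r)=\frac{B_r}{r!}\frac{1}{u_1\cdots u_r}\sum_{i=0}^{r-1}(-1)^i\binom{r-1}{i}u_{i+1}$ for $r\ge1$ ($B_r$ Bernoulli numbers, $B_1=-1/2$); $pal$ is the mould with $pal(\emptyset)=1$ determined recursively in depth by $dur\,pal=mu(pal,dupal)$. A mould $M$ is symmetral if $M(\emptyset)=1$ and $\sum_{\mathbf w\in sh(\mathbf u,\mathbf v)}M(\mathbf w)=M(\mathbf u)M(\mathbf v)$ for all $\mathbf u=(u_1..u_s)$, $\mathbf v=(u_{s+1}..u_r)$, $sh$ the shuffle of sequences. *)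

(* Defs.v *)
From HB Require Import structures.
From mathcomp Require Import all_boot all_order all_algebra.
From mathcomp Require Import mpoly.

Set Implicit Arguments.
Unset Strict Implicit.
Unset Printing Implicit Defensive.

Import GRing.Theory.

Local Open Scope ring_scope.
Local Open Scope quotient_scope.

Notation "x %:F" := (@FracField.tofrac _ x).

(* A mould: for each depth r, a rational function in Q(u_1, ..., u_r).  The   *)
(* variable u_(i+1) is 'X_i.                                                  *)
Definition mould := forall r : nat, {fraction {mpoly rat[r]}}.

(* Numerator and denominator are those of the canonical representative.  When *)
(* the entries of w are distinct variables, the only case used below, no      *)
(* denominator vanishes and the value is that of any fraction representing    *)
(* M (size w); see mould_at_frac.                                             *)
Definition mould_at (n : nat) (M : mould) (w : seq {mpoly rat[n]}) :
    {fraction {mpoly rat[n]}} :=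
  let f := repr (M (size w)) in
  ((\n_f)%R \mPo in_tuple w)%:F / ((\d_f)%R \mPo in_tuple w)%:F.

Notation "M @[ w ]" := (mould_at M w) (at level 10, format "M @[ w ]").

Definition letters (r : nat) : seq {mpoly rat[r]} := [seq 'X_i | i : 'I_r].

Definition mu (A B : mould) : mould := fun r =>
  \sum_(i < r.+1) A@[take i (letters r)] * B@[drop i (letters r)].

Definition dur (A : mould) : mould := fun r => (\sum_(i < r) 'X_i)%:F * A r.

(* [:: B_0; ...; B_n], from \sum_(k <= n) 'C(n.+1, k) B_k = 0 for n > 0. *)
Fixpoint bernoulli_seq (n : nat) : seq rat :=
  if n is m.+1 then
    let s := bernoulli_seq m in
    rcons s (- (m.+2%:R)^-1 * \sum_(k < m.+1) 'C(m.+2, k)%:R * s`_k)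
  else [:: 1].

Definition bernoulli (n : nat) : rat := (bernoulli_seq n)`_n.

Definition dupal : mould := fun r =>
  if r == 0%N then 0 else
  ((bernoulli r / r`!%:R)%:MP)%:F
  * ((\prod_(i < r) 'X_i)%:F)^-1
  * (\sum_(i < r) ((-1) ^+ i * 'C(r.-1, i)%:R) *: 'X_i)%:F.

(* dur pal = mu pal dupal determines pal r from the pal i with i < r, since   *)
(* dupal vanishes in depth 0; pal_iter n is correct in all depths r <= n.     *)
Fixpoint pal_iter (n : nat) : mould :=
  if n is m.+1 then
    fun r => if r == 0%N then 1
             else ((\sum_(i < r) 'X_i)%:F)^-1 * mu (pal_iter m) dupal r
  else fun r => if r == 0%N then 1 else 0.

Definition pal : mould := fun r => pal_iter r r.

(* All shuffles of s and t, listed with multiplicity. *)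
Fixpoint shuffle (T : Type) (s t : seq T) {struct s} : seq (seq T) :=
  if s is x :: s' then
    (fix shuffle_s (t : seq T) : seq (seq T) :=
       if t is y :: t' then
         [seq x :: w | w <- shuffle s' t] ++ [seq y :: w | w <- shuffle_s t']
       else [:: s]) t
  else [:: t].

Definition symmetral (M : mould) : Prop :=
  M 0%N = 1 /\
  forall r s : nat, (s <= r)%N ->
    let u := take s (letters r) in
    let v := drop s (letters r) in
    \sum_(w <- shuffle u v) M@[w] = M@[u] * M@[v].

Lemma mulr_denom (R : idomainType) (f : {fraction R}) :
  f * (\d_(repr f))%:F = (\n_(repr f))%:F.
Proof.
set x := repr f; rewrite -[f]reprK -/x; unlock FracField.tofrac.
rewrite -[LHS]/(FracField.mul _ _) -FracField.pi_mul; apply/eqmodP => /=.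
by rewrite /FracField.equivf /FracField.mulf !numden_Ratio ?mulr1 ?oner_neq0
  ?denom_ratioP // mulrC.
Qed.

Lemma comp_letters_neq0 (n : nat) (w : seq {mpoly rat[n]})
    (p : {mpoly rat[size w]}) :
  uniq w -> {subset w <= letters n} -> p != 0 -> p \mPo in_tuple w != 0.
Proof.
move=> uw sw; apply: contraNneq => pw0; apply/eqP.
pose t := [tuple oapp (fun j : 'I_(size w) => 'X_j : {mpoly rat[size w]}) 0
             (insub (index 'X_i w)) | i < n].
have wt i : tnth (in_tuple w) i \mPo t = 'X_i.
  have /sw/mapP[j _ wj] := mem_tnth i (in_tuple w).
  rewrite wj comp_mpolyXU -tnth_nth tnth_mktuple -wj (tnth_nth 0) /=.
  by rewrite index_uniq ?ltn_ord // valK.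
suff <- : (p \mPo in_tuple w) \mPo t = p by rewrite pw0 comp_mpoly0.
rewrite [X in X \mPo t]comp_mpolyE raddf_sum [RHS]mpolyE; apply: eq_bigr => m _ /=.
rewrite comp_mpolyZ rmorph_prod mpolyXE_id /=; congr (_ *: _).
by apply: eq_bigr => i _; rewrite rmorphXn /= wt.
Qed.

Lemma mould_at_frac (n : nat) (M : mould) (w : seq {mpoly rat[n]})
    (p q : {mpoly rat[size w]}) :
  uniq w -> {subset w <= letters n} -> q != 0 -> M (size w) = p%:F / q%:F ->
  M@[w] = (p \mPo in_tuple w)%:F / (q \mPo in_tuple w)%:F.
Proof.
rewrite /mould_at => uw sw.
move: (M _) (mulr_denom (M (size w))) => f nE q0 fE.
have E : \n_(repr f) * q = p * \d_(repr f).
  apply/eqP; rewrite -tofrac_eq !tofracM -nE [X in X * _ * _]fE mulrAC.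
  by rewrite divfK ?tofrac_eq0.
apply/eqP; rewrite eqr_div ?tofrac_eq0 ?comp_letters_neq0 ?denom_ratioP //.
by rewrite -!tofracM -!rmorphM /= E.
Qed.

Lemma size_letters (r : nat) : size (letters r) = r.
Proof. by rewrite size_image card_ord. Qed.

Lemma sum_letters_neq0 (r : nat) : (0 < r)%N ->
  \sum_(i < r) 'X_i != 0 :> {mpoly rat[r]}.
Proof.
case: r => // r _; apply/eqP => /(congr1 (meval (fun=> 1))).
rewrite raddf_sum raddf0 /= (eq_bigr (fun=> 1)) => [|i _]; last by rewrite mevalXU.
by apply/eqP; rewrite sumr_const card_ord Num.Theory.pnatr_eq0.
Qed.

Lemma size_bernoulli_seq (n : nat) : size (bernoulli_seq n) = n.+1.
Proof. by elim: n => //= n IHn; rewrite size_rcons IHn. Qed.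

Lemma nth_bernoulli_seq (n k : nat) :
  (k <= n)%N -> (bernoulli_seq n)`_k = bernoulli k.
Proof.
elim: n => [|n IHn]; first by rewrite leqn0 => /eqP->.
rewrite leq_eqVlt => /orP[/eqP-> //|lekn].
by rewrite /= nth_rcons size_bernoulli_seq lekn IHn.
Qed.

Lemma bernoulli0 : bernoulli 0 = 1. Proof. by []. Qed.

Lemma bernoulli1 : bernoulli 1 = - 2%:R^-1.
Proof. by rewrite /bernoulli /= big_ord1 /= bin0 !mulr1. Qed.

Lemma sum_bernoulli (n : nat) : (0 < n)%N ->
  \sum_(k < n.+1) 'C(n.+1, k)%:R * bernoulli k = 0.
Proof.
case: n => // n _; rewrite big_ord_recr /= binSn [bernoulli n.+1]/bernoulli /=.
rewrite nth_rcons size_bernoulli_seq ltnn eqxx mulrA mulrN divff; last first.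
  by rewrite Num.Theory.pnatr_eq0.
rewrite mulN1r; apply/eqP; rewrite subr_eq0; apply/eqP.
by apply: eq_bigr => k _; rewrite nth_bernoulli_seq // -ltnS.
Qed.

Lemma dupal_at_nil (n : nat) : dupal@[[::] : seq {mpoly rat[n]}] = 0.
Proof.
rewrite /mould_at; move: (mulr_denom (dupal 0)); rewrite mul0r.
move=> /esym/eqP; rewrite tofrac_eq0 => /eqP /= ->.
by rewrite comp_mpoly0 tofrac0 mul0r.
Qed.

Lemma mu_dupalE (A : mould) (r : nat) :
  mu A dupal r =
  \sum_(i < r) A@[take i (letters r)] * dupal@[drop i (letters r)].
Proof.
rewrite /mu big_ord_recr /= drop_oversize ?size_letters //.
by rewrite dupal_at_nil mulr0 addr0.
Qed.

Lemma eq_mu_dupal (A A' : mould) (r : nat) :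
  (forall i, (i < r)%N -> A i = A' i) -> mu A dupal r = mu A' dupal r.
Proof.
move=> eqA; rewrite !mu_dupalE; apply: eq_bigr => i _; congr (_ * _).
by rewrite /mould_at eqA // size_takel ?size_letters // ltnW.
Qed.

Lemma pal_iterE (n r : nat) : (r <= n)%N -> pal_iter n r = pal r.
Proof.
elim/ltn_ind: r n => -[|r] IHr [|n] //=; rewrite ltnS => lern.
rewrite /pal /=; congr (_ * _); apply: eq_mu_dupal => i lti.
have leir : (i <= r)%N by rewrite -ltnS.
by rewrite (IHr i lti n (leq_trans leir lern)) (IHr i lti r leir).
Qed.

Lemma pal0 : pal 0%N = 1. Proof. by []. Qed.

Lemma dur_pal (r : nat) : dur pal r = mu pal dupal r.
Proof.
case: r => [|r]; first by rewrite mu_dupalE /dur !big_ord0 tofrac0 mul0r.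
rewrite /dur {1}/pal /= mulVKf ?tofrac_eq0 ?sum_letters_neq0 //.
by apply: eq_mu_dupal => i; rewrite ltnS => /pal_iterE.
Qed.

Lemma pal_unique (M : mould) :
  M 0%N = 1 -> (forall r, dur M r = mu M dupal r) -> forall r, M r = pal r.
Proof.
move=> M0 durM; elim/ltn_ind => -[|r] IHr; first by rewrite M0.
apply: (@mulfI _ (\sum_(i < r.+1) 'X_i)%:F).
  by rewrite tofrac_eq0 sum_letters_neq0.
by rewrite -!/(dur _ r.+1) durM dur_pal; apply: eq_mu_dupal.
Qed.

(* Main.v *)
(* Up to the symmetric factor B_r / (r! u_1 ... u_r), dupal in depth r is the
   (r-1)-fold iterated bracket of the depth 1 mould u_1 with the depth 1 mould 1,
   hence alternal.  Multiplication by the sum of the letters is a derivation for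
   mu, and deconcatenation is a morphism for the shuffle product, so the equation
   dur pal = mu pal dupal turns alternality of dupal into symmetrality of pal,
   by induction on the depth. *)

From mathcomp Require Import all_boot all_order all_algebra.
From mathcomp Require Import mpoly ring.
Require Import Defs.

Set Implicit Arguments.
Unset Strict Implicit.
Unset Printing Implicit Defensive.

Import GRing.Theory.

Local Open Scope ring_scope.

(** Each [K i j] enters through [E i.+1 j] and each [L i j] through [E i j.+1]. In [shsum_wmul] the
    two families come from shuffles that begin with a letter of the one word or of the other. *)
Lemma sum_pascal (V : nmodType) (E K L : nat -> nat -> V) (m n : nat) :
    (forall i, E i.+1 0%N = K i 0%N) -> (forall j, E 0%N j.+1 = L 0%N j) ->
    (forall i j, E i.+1 j.+1 = K i j.+1 + L i.+1 j) ->
  \sum_(i < m.+1) \sum_(j < n.+1) E i j =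
  E 0%N 0%N + \sum_(i < m) \sum_(j < n.+1) K i j
            + \sum_(i < m.+1) \sum_(j < n) L i j.
Proof.
move=> E0 E0r E1; rewrite big_ord_recl big_ord_recl /=.
rewrite [X in _ + X = _](_ : _ = \sum_(i < m) \sum_(j < n.+1) K i j
  + \sum_(i < m) \sum_(j < n) L i.+1 j); last first.
  rewrite -big_split; apply: eq_bigr => i _ /=.
  rewrite !big_ord_recl E0 -addrA -big_split; congr (_ + _).
  by apply: eq_bigr => j _; apply: E1.
rewrite [X in _ = _ + X]big_ord_recl (eq_bigr (fun j : 'I_n => L 0%N j)).
  by rewrite addrACA.
by move=> j _; apply: E0r.
Qed.

(** * Shuffle sums and deconcatenation on words *)

Section Words.
Variables (T : eqType) (F : fieldType).
Implicit Types (f g h : seq T -> F) (u v w : seq T).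

Definition shsum f u v := \sum_(w <- shuffle u v) f w.

Definition wmul f g w := \sum_(i < (size w).+1) f (take i w) * g (drop i w).

Definition walternal f :=
  f [::] = 0 /\ forall u v, u != [::] -> v != [::] -> shsum f u v = 0.

Lemma shuffles0 u : shuffle u [::] = [:: u].
Proof. by case: u. Qed.

Lemma shuffle_cons x u y v : shuffle (x :: u) (y :: v) =
  [seq x :: w | w <- shuffle u (y :: v)] ++ [seq y :: w | w <- shuffle (x :: u) v].
Proof. by []. Qed.

Lemma shsum0s f v : shsum f [::] v = f v.
Proof. by rewrite /shsum big_seq1. Qed.

Lemma shsums0 f u : shsum f u [::] = f u.
Proof. by rewrite /shsum shuffles0 big_seq1. Qed.

Lemma shsum_cons f x u y v : shsum f (x :: u) (y :: v) =
  shsum (fun w => f (x :: w)) u (y :: v) + shsum (fun w => f (y :: w)) (x :: u) v.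
Proof. by rewrite /shsum shuffle_cons big_cat !big_map. Qed.

Lemma eq_shsum f g u v : f =1 g -> shsum f u v = shsum g u v.
Proof. by move=> fg; apply: eq_bigr => w _. Qed.

Lemma shsumD f g u v :
  shsum (fun w => f w + g w) u v = shsum f u v + shsum g u v.
Proof. exact: big_split. Qed.

Lemma shsumZ c f u v : shsum (fun w => c * f w) u v = c * shsum f u v.
Proof. by rewrite /shsum mulr_sumr. Qed.

Lemma shuffle_perm u v w : w \in shuffle u v -> perm_eq w (u ++ v).
Proof.
elim: u v w => [|x u IHu] v w; first by rewrite mem_seq1 => /eqP->.
elim: v w => [|y v IHv] w; first by rewrite mem_seq1 => /eqP->; rewrite cats0.
rewrite shuffle_cons mem_cat => /orP[] /mapP[w' w'P ->].
  by rewrite /= perm_cons IHu.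
by rewrite perm_sym -[y :: v]cat1s perm_catCA /= perm_cons perm_sym IHv.
Qed.

Lemma wmul0 f g : wmul f g [::] = f [::] * g [::].
Proof. by rewrite /wmul big_ord1. Qed.

Lemma wmul_cons f g x w :
  wmul f g (x :: w) = f [::] * g (x :: w) + wmul (fun w => f (x :: w)) g w.
Proof. by rewrite /wmul big_ord_recl. Qed.

(** Induction on both words through the first letter of a shuffle. The cut before it contributes [f
    [::]]; all other cuts replace [f] by [fun w => f (x :: w)], so [f] must stay general. *)
Lemma shsum_wmul f g u v :
  shsum (wmul f g) u v =
  \sum_(i < (size u).+1) \sum_(j < (size v).+1)
    shsum f (take i u) (take j v) * shsum g (drop i u) (drop j v).
Proof.
elim: u f v => [|x u IHu] f v.
  by rewrite shsum0s big_ord1; apply: eq_bigr => j _; rewrite !shsum0s.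
elim: v f => [|y v IHv] f.
  by rewrite shsums0; apply: eq_bigr => i _; rewrite big_ord1 !shsums0.
rewrite shsum_cons !(eq_shsum _ _ (wmul_cons _ _ _)) !shsumD !shsumZ IHu IHv.
rewrite addrACA -mulrDr -shsum_cons.
rewrite addrA -[f [::]]shsum0s; apply/esym.
pose E h u v i j := shsum h (take i u) (take j v) * shsum g (drop i u) (drop j v).
apply: (@sum_pascal _ (E f (x :: u) (y :: v))
  (E (fun w => f (x :: w)) u (y :: v)) (E (fun w => f (y :: w)) (x :: u) v))
  => [i|j|i j]; rewrite /E /=.
- by rewrite !shsums0.
- by rewrite !shsum0s.
- by rewrite shsum_cons mulrDl.
Qed.



(** Alternality of [g] kills every pair of cuts with two nonempty tails. The corner with both tails
    empty lies in both sums, harmlessly since [g [::] = 0]. *)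
Lemma shsum_wmul_alternal f g u v : walternal g ->
  shsum (wmul f g) u v =
  \sum_(i < (size u).+1) shsum f (take i u) v * g (drop i u) +
  \sum_(j < (size v).+1) shsum f u (take j v) * g (drop j v).
Proof.
move=> [g0 gA]; rewrite shsum_wmul.
have gE u' v' : shsum g u' v' = g u' *+ (v' == [::]) + g v' *+ (u' == [::]).
  case: (altP (u' =P [::])) => [->|u'0]; first by rewrite shsum0s g0 mul0rn add0r.
  case: (altP (v' =P [::])) => [->|v'0]; first by rewrite shsums0 g0 addr0.
  by rewrite gA // addr0.
pose E i j := shsum f (take i u) (take j v).
rewrite (eq_bigr (fun i : 'I__ => \sum_(j < (size v).+1)
    E i j * g (drop i u) *+ (drop j v == [::]) +
  \sum_(j < (size v).+1) E i j * g (drop j v) *+ (drop i u == [::])))=> [|i _].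
  have dropE w (i : 'I_(size w).+1) : (drop i w == [::]) = (i == ord_max).
    by rewrite -size_eq0 size_drop subn_eq0 -val_eqE eqn_leq /= -(ltnS i) ltn_ord.
  rewrite big_split; congr (_ + _).
    apply: eq_bigr => i _; rewrite (bigD1 ord_max) //= drop_size eqxx /E take_size.
    by rewrite big1 ?addr0 // => j /negPf jm; rewrite dropE jm mulr0n.
  rewrite exchange_big; apply: eq_bigr => j _.
  rewrite (bigD1 ord_max) //= drop_size eqxx /E take_size.
  by rewrite big1 ?addr0 // => i /negPf im; rewrite dropE im mulr0n.
rewrite -big_split; apply: eq_bigr => j _.
by rewrite gE mulrDr !mulrnAr.
Qed.

(** On nonempty words the shuffle sum of [wmul h k] reduces to [h v * k u + h u * k v], symmetric in
    [h] and [k], so the commutator cancels. *)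
Lemma bracket_alternal f g : walternal f -> walternal g ->
  walternal (fun w => wmul f g w - wmul g f w).
Proof.
have aux h k u v : walternal h -> walternal k -> u != [::] -> v != [::] ->
  shsum (wmul h k) u v = h v * k u + h u * k v.
  move=> hA kA; case: u => // x u _; case: v => // y v _.
  rewrite shsum_wmul_alternal //; congr (_ + _).
    rewrite big_ord_recl take0 shsum0s drop0 big1 ?addr0 // => i _.
    by rewrite hA.2 ?mul0r.
  rewrite big_ord_recl take0 shsums0 drop0 big1 ?addr0 // => i _.
  by rewrite hA.2 ?mul0r.
move=> fA gA; split=> [|u v u0 v0]; first by rewrite !wmul0 fA.1 gA.1 mulr0 subrr.
rewrite /shsum sumrB -!/(shsum _ _ _) !aux //; ring.
Qed.

(** Induction on the total length: both sides are compared after multiplication by the nonzero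
    weight of [u ++ v], which is the sum of the weights of [u] and [v]. *)
Lemma symmetral_of_derivation (ok : pred (seq T)) (wt : T -> F) (P D : seq T -> F) :
    (forall u v, perm_eq u v -> ok u -> ok v) ->
    (forall u v, ok (u ++ v) -> ok u && ok v) ->
    (forall w, ok w -> w != [::] -> \sum_(x <- w) wt x != 0) ->
    P [::] = 1 -> walternal D ->
    (forall w, ok w -> (\sum_(x <- w) wt x) * P w = wmul P D w) ->
  forall u v, ok (u ++ v) -> shsum P u v = P u * P v.
Proof.
move=> okp okc wt0 P0 DA PD u v.
have [n] := ubnP (size u + size v); elim: n u v => // n IH u v.
rewrite ltnS => ltn uv.
have [->|u0] := eqVneq u [::]; first by rewrite shsum0s P0 mul1r.
have [->|v0] := eqVneq v [::]; first by rewrite shsums0 P0 mulr1.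
have uv0 : u ++ v != [::] by case: (u) u0.
apply: (mulfI (wt0 _ uv uv0)).
(* Shuffling preserves the weight, so it enters the sum and [PD] applies to each shuffle. *)
have -> : (\sum_(x <- u ++ v) wt x) * shsum P u v = shsum (wmul P D) u v.
  rewrite /shsum mulr_sumr; apply: eq_big_seq => w /shuffle_perm wuv.
  rewrite -(perm_big _ wuv) PD //; apply: okp uv; by rewrite perm_sym.
have /andP[oku okv] := okc _ _ uv.
rewrite shsum_wmul_alternal // big_cat mulrDl mulrA PD //.
rewrite [_ * (_ * _)]mulrCA PD // /wmul mulr_suml mulr_sumr; congr (_ + _).
  (* The cut at the end of [u] would call for the claim being proved, but [D [::] = 0] removes it;
     the other cuts shorten [u]. *)
  apply: eq_bigr => i _; have := ltn_ord i; rewrite ltnS leq_eqVlt => /orP[/eqP->|iu].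
    by rewrite drop_size DA.1 !mulr0 mul0r.
  rewrite IH 1?mulrAC //.
    by apply: leq_trans ltn; rewrite ltn_add2r size_takel // ltnW.
  have /okc/andP[] // : ok ((take i u ++ v) ++ drop i u).
  by apply: okp uv; rewrite -{1}(cat_take_drop i u) perm_sym perm_catAC.
apply: eq_bigr => i _; have := ltn_ord i; rewrite ltnS leq_eqVlt => /orP[/eqP->|iv].
  by rewrite drop_size DA.1 !mulr0.
rewrite IH 1?mulrA //.
  by apply: leq_trans ltn; rewrite ltn_add2l size_takel // ltnW.
have /okc/andP[] // : ok ((u ++ take i v) ++ drop i v).
by rewrite -catA cat_take_drop.
Qed.

(** * Alternality of the binomial sums *)

Lemma size1_alternal f :
  (forall w, size w != 1%N -> f w = 0) -> walternal f.
Proof.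
move=> f1; split=> [|u v u0 v0]; first exact: f1.
rewrite /shsum big_seq big1 // => w /shuffle_perm/perm_size wuv.
rewrite f1 // wuv size_cat; clear wuv.
by case: u v u0 v0 => [//|x u] [//|y v]; rewrite /= addnS.
Qed.

(** The last factor of [dupal] in depth [k.+1], extended by zero to other lengths so that
    alternality makes sense over all words. *)
Definition altsum (c : T -> F) k w : F :=
  if size w == k.+1 then
    \sum_(i < k.+1) (-1) ^+ i * 'C(k, i)%:R * (map c w)`_i
  else 0.

(* [altsum c k] is the iterated bracket [[c, E], ..., E] with [k] copies of [E],
   where [E] is the indicator of the words of length 1. *)
Lemma altsum_alternal c k : walternal (altsum c k).
Proof.
elim: k => [|k IHk]; first by apply: size1_alternal => w /negPf; rewrite /altsum => ->.
pose E w : F := (size w == 1%N)%:R.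
have EA : walternal E by apply: size1_alternal => w; rewrite /E => /negPf ->.
have [B0 BA] := bracket_alternal IHk EA.
have fE w : altsum c k.+1 w = wmul (altsum c k) E w - wmul E (altsum c k) w.
  case: w => [|x w]; first by rewrite !wmul0 IHk.1 mul0r subrr.
  (* [E] vanishes off length 1, so the bracket keeps two cuts of [x :: w]: after its first letter
     and before its last. *)
  rewrite [X in _ - X]wmul_cons {2}/E mul0r add0r.
  rewrite [X in _ - X]/wmul big_ord_recl /= big1 ?addr0; last first.
    by move=> i _; rewrite [E _](_ : _ = 0) ?mul0r // /E /= size_takel.
  rewrite /wmul big_ord_recr /= big_ord_recr /= big1 => [|i _]; last first.
    rewrite [E _](_ : _ = 0) ?mulr0 // /E size_drop /= subSn 1?ltnW //.
    by rewrite eqSS subn_eq0 leqNgt ltn_ord.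
  rewrite drop_size [E [::]](_ : _ = 0) // mulr0 addr0 add0r /E.
  have -> : size (drop (size w) (x :: w)) = 1%N by rewrite size_drop /= subSnn.
  rewrite mulr1 take0 drop0 mul1r /altsum /= size_takel // eqSS.
  case: eqP => [sw|_]; last by rewrite subrr.
  (* Pascal's rule: the terms in ['C(k, i.+1)] and the leading one give the value on the word
     without its last letter, those in ['C(k, i)] the value on [w]. *)
  rewrite big_ord_recl (eq_bigr (fun i : 'I__ =>
     (-1) ^+ i.+1 * 'C(k, i.+1)%:R * (map c w)`_i
     - (-1) ^+ i * 'C(k, i)%:R * (map c w)`_i)) => [|i _]; last first.
    by rewrite /= binS natrD exprS; ring.
  rewrite sumrB addrA; congr (_ - _).
  rewrite map_take sw [RHS]big_ord_recl !bin0; congr (_ + _).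
  rewrite big_ord_recr /= bin_small // mulr0 mul0r addr0.
  apply: eq_bigr => i _; congr (_ * _).
  by rewrite nth_take add0n.
split; first by rewrite fE.
by move=> u v u0 v0; rewrite (eq_shsum _ _ fE) BA.
Qed.

End Words.

(** * Substitution in rational functions *)

Section Substitution.
Variables (r n : nat) (w : r.-tuple {mpoly rat[n]}).
Hypothesis w_inj : forall p : {mpoly rat[r]}, p != 0 -> p \mPo w != 0.
Implicit Types (p q : {mpoly rat[r]}) (f g : {fraction {mpoly rat[r]}}).

Definition frac_subst f : {fraction {mpoly rat[n]}} :=
  (\n_(repr f) \mPo w)%:F / (\d_(repr f) \mPo w)%:F.

(** Two representatives of a fraction satisfy a cross-multiplied polynomial identity, which
    substitution preserves; [w_inj] keeps the denominators nonzero. *)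
Lemma frac_substE p q : q != 0 ->
  frac_subst (p%:F / q%:F) = (p \mPo w)%:F / (q \mPo w)%:F.
Proof.
move=> q0; rewrite /frac_subst; set f := p%:F / q%:F.
have fq : f * q%:F = p%:F by rewrite divfK // tofrac_eq0.
have E : \n_(repr f) * q = p * \d_(repr f).
  by apply/eqP; rewrite -tofrac_eq !tofracM -mulr_denom mulrAC fq.
apply/eqP; rewrite eqr_div ?tofrac_eq0 ?w_inj ?denom_ratioP //.
by rewrite -!tofracM -!rmorphM /= E.
Qed.

Lemma frac_repr f : f = (\n_(repr f))%:F / (\d_(repr f))%:F.
Proof. by rewrite -mulr_denom mulfK // tofrac_eq0 denom_ratioP. Qed.

Lemma frac_subst_tofrac p : frac_subst p%:F = (p \mPo w)%:F.
Proof.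
by rewrite -[p%:F]divr1 -tofrac1 frac_substE ?oner_eq0 // rmorph1 tofrac1 divr1.
Qed.

Lemma frac_substM f g : frac_subst (f * g) = frac_subst f * frac_subst g.
Proof.
rewrite [X in frac_subst (X * _)]frac_repr [X in frac_subst (_ * X)]frac_repr.
rewrite mulf_div -!tofracM frac_substE ?mulf_neq0 ?denom_ratioP //.
by rewrite !rmorphM /= -mulf_div.
Qed.

Lemma frac_substD f g : frac_subst (f + g) = frac_subst f + frac_subst g.
Proof.
rewrite [X in frac_subst (X + _)]frac_repr [X in frac_subst (_ + X)]frac_repr.
rewrite addf_div ?tofrac_eq0 ?denom_ratioP //.
rewrite -!tofracM -tofracD frac_substE ?mulf_neq0 ?denom_ratioP //.
by rewrite !(rmorphD, rmorphM) /= addf_div ?tofrac_eq0 ?w_inj ?denom_ratioP.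
Qed.

Lemma frac_subst0 : frac_subst 0 = 0.
Proof. by rewrite -tofrac0 frac_subst_tofrac rmorph0. Qed.

Lemma frac_subst_sum (I : Type) (s : seq I) (f : I -> {fraction {mpoly rat[r]}}) :
  frac_subst (\sum_(i <- s) f i) = \sum_(i <- s) frac_subst (f i).
Proof. exact: (big_morph _ frac_substD frac_subst0). Qed.

Lemma frac_substV p : p != 0 -> frac_subst (p%:F)^-1 = ((p \mPo w)%:F)^-1.
Proof.
by move=> p0; rewrite -div1r -tofrac1 frac_substE // rmorph1 tofrac1 div1r.
Qed.

End Substitution.

(** Decouples the depth [r] from the dependent index [size w] by destructing their equality once. *)
Lemma mould_at_tuple (r n : nat) (M : mould) (w : r.-tuple {mpoly rat[n]}) :
  M@[w] = frac_subst w (M r).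
Proof.
case: w => w sw; have rE : size w = r by apply/eqP.
case: r / rE sw => sw.
by rewrite /mould_at /frac_subst /= (_ : in_tuple w = Tuple sw) //; apply: val_inj.
Qed.

(** Serves as [ok] in [symmetral_of_derivation]: the condition passes to shuffles and factors, and
    substituting such a word is injective. *)
Definition letter_word (n : nat) (w : seq {mpoly rat[n]}) : bool :=
  uniq w && all (mem (letters n)) w.

Lemma letter_word_perm n (u v : seq {mpoly rat[n]}) :
  perm_eq u v -> letter_word u -> letter_word v.
Proof. by move=> uv; rewrite /letter_word (perm_uniq uv) (perm_all _ uv). Qed.

Lemma letter_word_cat n (u v : seq {mpoly rat[n]}) :
  letter_word (u ++ v) -> letter_word u && letter_word v.
Proof.
rewrite /letter_word cat_uniq all_cat.
by move=> /andP[/and3P[-> _ ->] /andP[-> ->]].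
Qed.

Lemma letter_word_neq0 n (w : seq {mpoly rat[n]}) (p : {mpoly rat[size w]}) :
  letter_word w -> p != 0 -> p \mPo in_tuple w != 0.
Proof. by move=> /andP[uw /allP sw]; apply: comp_letters_neq0. Qed.

Lemma letters_word n : letter_word (letters n).
Proof.
apply/andP; split; last by apply/allP.
rewrite map_inj_uniq ?enum_uniq // => i j /(congr1 (mcoeff U_(j))).
by rewrite !mcoeffXU eqxx; case: eqP => // _ /eqP; rewrite eq_sym oner_eq0.
Qed.

Lemma mould_at0 n (M : mould) : M 0%N = 1 -> M@[[::] : seq {mpoly rat[n]}] = 1.
Proof.
move=> M0; rewrite -[LHS]/(frac_subst (in_tuple [::]) (M 0%N)) M0 -tofrac1.
by rewrite frac_subst_tofrac ?rmorph1 // => p; apply: letter_word_neq0.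
Qed.

Lemma comp_mpoly_comp (k r n : nat) (v : k.-tuple {mpoly rat[r]})
    (w : r.-tuple {mpoly rat[n]}) (p : {mpoly rat[k]}) :
  (p \mPo v) \mPo w = p \mPo [tuple of [seq q \mPo w | q <- v]].
Proof.
rewrite [X in X \mPo w]comp_mpolyEX [RHS]comp_mpolyEX raddf_sum.
apply: eq_bigr => m _ /=; rewrite comp_mpolyZ !comp_mpolyX rmorph_prod.
by congr (_ *: _); apply: eq_bigr => i _; rewrite rmorphXn tnth_map.
Qed.

Lemma prodX_neq0 (n : nat) : \prod_(i < n) 'X_i != 0 :> {mpoly rat[n]}.
Proof. by apply/prodf_neq0 => i _; rewrite -msize_poly_eq0 msizeX. Qed.

(** * Mould operations read on words of distinct letters *)

Section MouldWords.
Variables (n : nat) (w : seq {mpoly rat[n]}).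
Hypothesis wP : letter_word w.

Let w_inj := fun p => @letter_word_neq0 n w p wP.

Lemma map_comp_letters :
  [seq p \mPo in_tuple w | p <- letters (size w)] = w.
Proof.
rewrite -map_comp -[RHS](mkseq_nth 0) /mkseq -val_enum_ord -map_comp.
by apply: eq_map => i /=; rewrite comp_mpolyXU.
Qed.

(** Successive substitutions compose; [letter_word v] keeps the denominator nonzero after the inner
    one. *)
Lemma frac_subst_mould_at (M : mould) (v : seq {mpoly rat[size w]}) :
  letter_word v ->
  frac_subst (in_tuple w) (M@[v]) = M@[[seq p \mPo in_tuple w | p <- v]].
Proof.
move=> vP; pose v' := map_tuple (comp_mpoly (in_tuple w)) (in_tuple v).
rewrite -[RHS]/(M@[v']) mould_at_tuple {1}/mould_at /=.
rewrite frac_substE ?letter_word_neq0 ?denom_ratioP //.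
by rewrite !comp_mpoly_comp.
Qed.

Lemma mould_at_mu (A B : mould) :
  (mu A B)@[w] = wmul (fun v => A@[v]) (fun v => B@[v]) w.
Proof.
rewrite -[LHS]/(frac_subst (in_tuple w) (mu A B (size w))) frac_subst_sum //.
apply: eq_bigr => i _.
have /letter_word_cat/andP[tP dP] :
    letter_word (take i (letters (size w)) ++ drop i (letters (size w))).
  by rewrite cat_take_drop letters_word.
by rewrite frac_substM // !frac_subst_mould_at // map_take map_drop map_comp_letters.
Qed.

Lemma comp_sum_letters :
  (\sum_(i < size w) 'X_i) \mPo in_tuple w = \sum_(x <- w) x.
Proof.
rewrite -[in RHS]map_comp_letters big_map big_map -big_enum /=.
by rewrite raddf_sum.
Qed.

Lemma comp_prod_letters :
  (\prod_(i < size w) 'X_i) \mPo in_tuple w = \prod_(x <- w) x.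
Proof.
rewrite -[in RHS]map_comp_letters big_map big_map -big_enum /=.
by rewrite rmorph_prod.
Qed.

Lemma mould_at_dur (A : mould) : (dur A)@[w] = (\sum_(x <- w) x%:F) * A@[w].
Proof.
rewrite -[LHS]/(frac_subst (in_tuple w) (dur A (size w))) frac_substM //.
by rewrite frac_subst_tofrac // comp_sum_letters rmorph_sum.
Qed.

Lemma mould_at_dupal : dupal@[w] =
  (bernoulli (size w) / (size w)`!%:R)%:MP%:F / (\prod_(x <- w) x)%:F
  * altsum (@FracField.tofrac _) (size w).-1 w.
Proof.
rewrite -[LHS]/(frac_subst (in_tuple w) (dupal (size w))) /dupal.
(* On the empty word [(size w).-1] is 0 and [altsum] then asks for length 1, so the right side
   vanishes as [dupal] does. *)
have [w0|w0] := eqVneq (size w) 0%N.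
  by rewrite frac_subst0 // /altsum w0 mulr0.
rewrite !frac_substM // frac_substV ?prodX_neq0 // !frac_subst_tofrac //.
rewrite comp_mpolyC comp_prod_letters; congr (_ * _).
rewrite /altsum prednK ?lt0n // eqxx [X in X%:F]raddf_sum rmorph_sum.
apply: eq_bigr => i _ /=; rewrite comp_mpolyZ comp_mpolyXU.
rewrite -mul_mpolyC rmorphM /= (nth_map 0) //; congr (_ * _).
by rewrite !(rmorphM, rmorphXn, rmorphN1, rmorph_nat).
Qed.

Lemma letter_word_sum_neq0 : w != [::] -> \sum_(x <- w) x%:F != 0.
Proof.
rewrite -rmorph_sum tofrac_eq0 -comp_sum_letters -size_eq0 -lt0n => w0.
by rewrite letter_word_neq0 // sum_letters_neq0.
Qed.

End MouldWords.

(** The prefactor is invariant under permuting the letters, hence constant over the shuffles. The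
    closed formula agrees with [dupal] on words of distinct letters by [mould_at_dupal]. *)
Lemma dupal_word_alternal n : walternal (fun w : seq {mpoly rat[n]} =>
  (bernoulli (size w) / (size w)`!%:R)%:MP%:F / (\prod_(x <- w) x)%:F
  * altsum (@FracField.tofrac _) (size w).-1 w).
Proof.
split=> [|u v u0 v0]; first by rewrite /altsum mulr0.
have [_ A0] := altsum_alternal (@FracField.tofrac {mpoly rat[n]}) (size (u ++ v)).-1.
pose c := (bernoulli (size (u ++ v)) / (size (u ++ v))`!%:R)%:MP%:F
  / (\prod_(x <- u ++ v) x)%:F.
rewrite -(mulr0 c) -(A0 u v) // /shsum mulr_sumr.
apply: eq_big_seq => w /shuffle_perm wuv.
by rewrite (perm_size wuv) (perm_big _ wuv).
Qed.

Theorem theorem4p3p4 : symmetral pal.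
Proof.
split=> // r s _ /=.
apply: (symmetral_of_derivation (@letter_word_perm r) (@letter_word_cat r)
  (@letter_word_sum_neq0 r) (mould_at0 r pal0) (dupal_word_alternal r)).
  move=> w wP; rewrite -mould_at_dur //.
  have -> : (dur pal)@[w] = (mu pal dupal)@[w] by rewrite /mould_at dur_pal.
  rewrite mould_at_mu //; apply: eq_bigr => i _; rewrite mould_at_dupal //.
  have /letter_word_cat/andP[] // : letter_word (take i w ++ drop i w).
  by rewrite cat_take_drop.
by rewrite cat_take_drop letters_word.
Qed.
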